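(* Let $p$ be a prime, $q$ a power of $p$, and $\mathbb{F}_q(t)$ the rational function field over $\mathbb{F}_q$. Let $r>1$ be an integer prime to $p$, and let $h(x)\in\mathbb{F}_q[x]$ be a polynomial of positive degree with $h(0)\neq 0$ which is not the $e$-th power of another element of $\mathbb{F}_q(t)$ for any divisor $e>1$ of $r$. For $a\in\mathbb{F}_q(t)\setminus\mathbb{F}_q$, let $X_{h,r,a}$ be the smooth projective curve over $\mathbb{F}_q(t)$ associated to the equation $y^r=h(x)h(a/x)$. Assume that $r$ divides $q^f+1$ for some integer $f\ge 1$. Then, as $a$ varies through $\mathbb{F}_q(t)\setminus\mathbb{F}_q$, the number of $\mathbb{F}_q(t)$-rational points of $X_{h,r,a}$ is unbounded.
   Context: Under these hypotheses $X_{h,r,a}$ is absolutely irreducible and its genus does not depend on $a$. *)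

(* Defs.v *)
From HB Require Import structures.
From mathcomp Require Import all_boot all_order all_algebra all_field.
From mathcomp Require Import mpoly.

Set Implicit Arguments.
Unset Strict Implicit.
Unset Printing Implicit Defensive.

Import GRing.Theory.
Local Open Scope ring_scope.

Notation ratfun k := {fraction {poly k}}.

Definition ratC (k : fieldType) (c : k) : ratfun k := @tofrac {poly k} (polyC c).
HB.instance Definition _ (k : fieldType) :=
  GRing.RMorphism.copy (@ratC k) (@tofrac {poly k} \o @polyC k).

Definition ratX (k : fieldType) : ratfun k := @tofrac {poly k} 'X.

(* A closed subscheme of the projective space P^n over k, given by finitely
   many homogeneous equations in n + 1 variables. *)
Record projScheme (k : fieldType) := ProjScheme {
  ps_dim : nat;
  ps_eqs : seq {mpoly k[ps_dim.+1]};
  ps_homog : all (fun G : {mpoly k[ps_dim.+1]} => G \is homog mdeg) ps_eqs }.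

Section ProjScheme.
Variables (k : fieldType) (X : projScheme k).
Let n := ps_dim X.

(* P is a vector of homogeneous coordinates of an E-valued point of X, for an
   extension iota : k -> E. *)
Definition is_point (E : fieldType) (iota : {rmorphism k -> E})
    (P : 'rV[E]_n.+1) : Prop :=
  P != 0 /\ forall G, G \in ps_eqs X -> mmap iota (P 0) G = 0.

Definition jacobian (E : fieldType) (iota : {rmorphism k -> E})
    (P : 'rV[E]_n.+1) : 'M[E]_(size (ps_eqs X), n.+1) :=
  \matrix_(i, j) mmap iota (P 0) (mderiv j (ps_eqs X)`_i).

(* The Jacobian criterion for smoothness of relative dimension 1: the rank is
   n - 1 at every point with values in a field extension.  (It bounds the
   dimension of X at each point by 1; that the dimension is exactly 1 is
   enforced by is_ratfun_ring below.) *)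
Definition smooth_curve : Prop :=
  forall (E : fieldType) (iota : {rmorphism k -> E}) (P : 'rV[E]_n.+1),
    is_point iota P -> (\rank (jacobian iota P)).+1 = n.

(* The k-algebra A (with structure map c) is the ring of rational functions of
   X.  The vector phi is the morphism Spec A -> P^n which includes the generic
   points of X: it lies on X; a form which vanishes at phi vanishes on all of X;
   and the elements of A are the quotients of forms of equal degrees at phi,
   with invertible denominator.  When A is a field, X is irreducible and A is
   its function field. *)
Definition is_ratfun_ring (A : comNzRingType) (c : {rmorphism k -> A}) : Prop :=
  exists phi : 'I_n.+1 -> A,
  [/\ forall G, G \in ps_eqs X -> mmap c phi G = 0,
      forall (d : nat) (G : {mpoly k[n.+1]}),
        G \is d.-homog -> mmap c phi G = 0 ->
        forall (E : fieldType) (iota : {rmorphism k -> E}) (P : 'rV[E]_n.+1),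
          is_point iota P -> mmap iota (P 0) G = 0
    & forall z : A, exists (d : nat) (B C : {mpoly k[n.+1]}) (w : A),
        [/\ B \is d.-homog, C \is d.-homog,
            w * mmap c phi C = 1 & z = w * mmap c phi B]].

Definition at_least_rational_points (N : nat) : Prop :=
  exists P : 'I_N -> 'rV[k]_n.+1,
    (forall i, is_point idfun (P i)) /\
    (forall i j, i != j -> forall l : k, P i <> l *: P j).

End ProjScheme.

(* X is a smooth projective model of the affine plane curve y^r = f(x), whose
   ring of rational functions is k(x)[y]/(y^r - f) (for r > 0: then y^r - f is
   monic of positive degree, and mk_monic in {poly %/ _} leaves it unchanged).
   This ring is the function field of the curve when y^r - f is irreducible; if
   only f != 0 and r is prime to the characteristic of k, it is a product of
   function fields and X is a disjoint union of curves. *)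
Definition smooth_model (k : fieldType) (r : nat) (f : ratfun k)
    (X : projScheme k) : Prop :=
  let g : {poly ratfun k} := 'X^r - f%:P in
  smooth_curve X /\
  @is_ratfun_ring k X {poly %/ g} (qpolyC g \o @ratC k).

(* h(x) h(a/x), as an element of F(t)(x). *)
Definition hha (F : fieldType) (h : {poly F}) (a : ratfun F) :
    ratfun (ratfun F) :=
  let hx := map_poly (@ratC (ratfun F) \o @ratC F) h in
  let x := ratX (ratfun F) in
  hx.[x] * hx.[ratC a / x].

Definition nonconstant (F : fieldType) (a : ratfun F) : Prop :=
  forall c : F, a <> ratC c.

(* Main.v *)
From HB Require Import structures.
Require Import Defs.
From mathcomp Require Import all_boot all_order all_algebra all_field.
From mathcomp Require Import mpoly ring.
From mathcomp.classical Require boolp.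

(**
  Take a = t^M, where M is the product of the numbers Q_i + 1 with
  Q_i = q^(f (2 i + 1)); r divides each of them.  For x_i = t^(M / (Q_i + 1))
  one has a / x_i = x_i^Q_i, and h has coefficients in F_q, so
  h(x_i) h(a / x_i) = h(x_i)^(Q_i + 1) is a nonzero r-th power: the affine
  curve has the rational points (x_i, y_i).

  To carry them to an arbitrary smooth model X, expand at (x_i, y_i): by
  Hensel's lemma the y-coordinate is a power series in s = x - x_i, so the
  generic point of X becomes a vector of power series, which, divided by the
  largest possible power of s, has a value P_i in X(k) at s = 0.  If P_i = P_j,
  the two formal branches pass through one point of X.  The Jacobian criterion
  and Nakayama's lemma give a function u such that every function is a power of
  u times a unit there, so the orders of vanishing along the two branches are
  proportional.  Hence x - x_i, which vanishes on the first branch, vanishes on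
  the second, and x_i = x_j.
*)

Import GRing.Theory.
Set Implicit Arguments.
Unset Strict Implicit.
Unset Printing Implicit Defensive.
Local Open Scope ring_scope.

(** * Formal power series *)

Record fps (k : nzRingType) := Fps { fcoef : nat -> k }.

Section Fps.
Variable k : comNzRingType.
Local Notation fps := (fps k).
Implicit Types a b c : fps.

(** Equality of power series is not decidable, so the equality and choice structures are taken from
    classical logic. *)
HB.instance Definition _ := boolp.gen_eqMixin fps.
HB.instance Definition _ := boolp.gen_choiceMixin fps.

Lemma fpsP a b : (forall i, fcoef a i = fcoef b i) -> a = b.
Proof. by case: a b => a [b] /= ab; congr Fps; apply/boolp.funext. Qed.

Definition fps_of_poly (p : {poly k}) : fps := Fps (fun i => p`_i).
Definition fps_trunc m a : {poly k} := \poly_(i < m) fcoef a i.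

Definition fps_add a b := Fps (fun i => fcoef a i + fcoef b i).
Definition fps_opp a := Fps (fun i => - fcoef a i).
Definition fps_mul a b :=
  Fps (fun i => \sum_(j < i.+1) fcoef a j * fcoef b (i - j)).

Lemma fps_addA : associative fps_add.
Proof. by move=> a b c; apply: fpsP => i /=; rewrite addrA. Qed.
Lemma fps_addC : commutative fps_add.
Proof. by move=> a b; apply: fpsP => i /=; rewrite addrC. Qed.
Lemma fps_add0 : left_id (fps_of_poly 0) fps_add.
Proof. by move=> a; apply: fpsP => i /=; rewrite coef0 add0r. Qed.
Lemma fps_addN : left_inverse (fps_of_poly 0) fps_opp fps_add.
Proof. by move=> a; apply: fpsP => i /=; rewrite coef0 addNr. Qed.
HB.instance Definition _ :=
  GRing.isZmodule.Build fps fps_addA fps_addC fps_add0 fps_addN.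

(** A coefficient of a product depends on finitely many coefficients of the factors. Commutativity
    and associativity are thereby inherited from [{poly k}]. *)
Lemma fcoef_mul_trunc m i a b : (i < m)%N ->
  fcoef (fps_mul a b) i = (fps_trunc m a * fps_trunc m b)`_i.
Proof.
move=> im; rewrite coefM /=; apply: eq_bigr => j _.
by rewrite !coef_poly !(leq_ltn_trans _ im) ?leq_subr // -ltnS.
Qed.

Lemma fps_mulC : commutative fps_mul.
Proof. by move=> a b; apply: fpsP => i; rewrite !(@fcoef_mul_trunc i.+1) // mulrC. Qed.

Lemma fps_mulA : associative fps_mul.
Proof.
move=> a b c; apply: fpsP => i; rewrite !(@fcoef_mul_trunc i.+1) //.
have trM x y z : (fps_trunc i.+1 (fps_mul x y) * fps_trunc i.+1 z)`_i =
    (fps_trunc i.+1 x * fps_trunc i.+1 y * fps_trunc i.+1 z)`_i.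
  rewrite !(coefM _ (fps_trunc _ z)); apply: eq_bigr => j _; congr (_ * _).
  by rewrite [LHS]coef_poly ltn_ord (@fcoef_mul_trunc i.+1).
by rewrite mulrC !trM; congr (_`_i); rewrite mulrC mulrA.
Qed.

Lemma fps_mul1 : left_id (fps_of_poly 1) fps_mul.
Proof.
move=> a; apply: fpsP => i /=; rewrite big_ord_recl subn0 coef1 mul1r big1 ?addr0 //.
by move=> j _; rewrite coef1 mul0r.
Qed.
Lemma fps_mulD : left_distributive fps_mul fps_add.
Proof.
move=> a b c; apply: fpsP => i /=; rewrite -big_split; apply: eq_bigr => j _.
by rewrite mulrDl.
Qed.
Lemma fps_1neq0 : fps_of_poly 1 != 0.
Proof.
apply/eqP => /(congr1 (fun a => fcoef a 0)) /eqP.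
by rewrite /= coef1 coef0 oner_eq0.
Qed.
HB.instance Definition _ := GRing.Zmodule_isComNzRing.Build fps
  fps_mulA fps_mulC fps_mul1 fps_mulD fps_1neq0.

Lemma fcoefM a b i : fcoef (a * b) i = \sum_(j < i.+1) fcoef a j * fcoef b (i - j).
Proof. by []. Qed.

Lemma fps_of_poly_zmod : zmod_morphism fps_of_poly.
Proof. by move=> p q; apply: fpsP => i /=; rewrite coefB. Qed.
HB.instance Definition _ :=
  GRing.isZmodMorphism.Build {poly k} fps fps_of_poly fps_of_poly_zmod.
Lemma fps_of_poly_monoid : monoid_morphism fps_of_poly.
Proof. by split=> // p q; apply: fpsP => i /=; rewrite coefM. Qed.
HB.instance Definition _ :=
  GRing.isMonoidMorphism.Build {poly k} fps fps_of_poly fps_of_poly_monoid.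

(** Reduction modulo s, used below as the specialization at s = 0. *)
Definition fps0 a := fcoef a 0.
Lemma fps0_zmod : zmod_morphism fps0. Proof. by []. Qed.
HB.instance Definition _ := GRing.isZmodMorphism.Build fps k fps0 fps0_zmod.
Lemma fps0_monoid : monoid_morphism fps0.
Proof.
split; first by rewrite /fps0 /= coef1.
by move=> a b; rewrite /fps0 fcoefM big_ord1.
Qed.
HB.instance Definition _ := GRing.isMonoidMorphism.Build fps k fps0 fps0_monoid.

Definition fpsX : fps := fps_of_poly 'X.
Definition fpsC (c : k) : fps := fps_of_poly c%:P.
HB.instance Definition _ := GRing.RMorphism.copy fpsC (fps_of_poly \o polyC).

Lemma fps0C (c : k) : fps0 (fpsC c) = c. Proof. by rewrite /fps0 /= coefC. Qed.
Lemma fps0X : fps0 fpsX = 0. Proof. by rewrite /fps0 /= coefX. Qed.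

Lemma fcoefXnM m a i :
  fcoef (fpsX ^+ m * a) i = if (i < m)%N then 0 else fcoef a (i - m).
Proof.
rewrite /fpsX -rmorphXn fcoefM; case: ltnP => im.
  rewrite big1 // => j _; rewrite /= coefXn.
  by rewrite (ltn_eqF (leq_trans (ltn_ord j) im)) mul0r.
have mi : (m < i.+1)%N by [].
rewrite (bigD1 (Ordinal mi)) //= coefXn eqxx mul1r big1 ?addr0 // => j jm.
by rewrite coefXn (negPf (_ : (j != m :> nat))) ?mul0r //.
Qed.

(** No integral domain structure is put on [fps]. Cancellation of powers of s, together with
    [fps_unit], takes its place. *)
Lemma fpsXn_inj m : injective ( *%R (fpsX ^+ m)).
Proof.
move=> a b ab; apply: fpsP => i.
have: fcoef (fpsX ^+ m * a) (i + m) = fcoef (fpsX ^+ m * b) (i + m) by rewrite ab.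
rewrite !fcoefXnM.
by rewrite ltnNge leq_addl addnK.
Qed.

Definition fps_shift m a : fps := Fps (fun i => fcoef a (i + m)).

Lemma fps_shiftK m a : (forall i, (i < m)%N -> fcoef a i = 0) ->
  a = fpsX ^+ m * fps_shift m a.
Proof.
move=> a0; apply: fpsP => i; rewrite fcoefXnM.
by case: ltnP => im; [rewrite a0 | rewrite /= subnK].
Qed.

Lemma fps0_eq0 a : fps0 a = 0 -> a = fpsX * fps_shift 1 a.
Proof. by move=> a0; rewrite -[fpsX]expr1 -fps_shiftK // => -[]. Qed.

End Fps.
Arguments fps0 : simpl never.

(** * Hensel's lemma and units *)

Section Hensel.
Variable k : fieldType.
Local Notation fps := (fps k).

(** Newton iteration with the fixed slope [d]: each step corrects one coefficient, and [u m] is a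
    root modulo s^(m+1). *)
Lemma hensel (f : {poly fps}) (c : k) :
  fps0 f.[fpsC c] = 0 -> fps0 f^`().[fpsC c] != 0 ->
  exists2 a : fps, fps0 a = c & f.[a] = 0.
Proof.
move=> fc0 f'c0; set d := fps0 f^`().[fpsC c] in f'c0.
(* Taylor's formula to second order. Sizes 0 and 1 of [f] are treated apart because the sum in
   [nderiv_taylor] then has no linear term. *)
have taylor (a e : fps) : exists b, f.[a + e] = f.[a] + f^`().[a] * e + e ^+ 2 * b.
  have := nderiv_taylor f (mulrC a e) => ->.
  case E: (size f) => [|[|n]].
  - have ->: f = 0 by apply/eqP; rewrite -size_poly_eq0 E.
    by exists 0; rewrite !big_ord0 deriv0 !hornerE.
  - have/size1_polyC -> : (size f <= 1)%N by rewrite E.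
    by exists 0; rewrite big_ord1 derivC poly.nderivn0 !hornerE.
  rewrite 2!big_ord_recl /= poly.nderivn0 expr0 mulr1.
  rewrite -[bump 0 0]/1%N poly.nderivn1 expr1.
  exists (\sum_(i < n) f^`N(i.+2).[a] * e ^+ i).
  rewrite addrA mulr_sumr; congr (_ + _); apply: eq_bigr => i _.
  by rewrite [RHS]mulrCA -exprD.
pose step (m : nat) (a : fps) : fps :=
  a - fpsX k ^+ m.+1 * fpsC (fcoef f.[a] m.+1 / d).
pose fix u (m : nat) : fps := if m is m'.+1 then step m' (u m') else fpsC c.
have u0 m : fps0 (u m) = c.
  elim: m => [|m IH] /=; first exact: fps0C.
  by rewrite /step rmorphB rmorphM rmorphXn /= fps0X expr0n mul0r subr0.
have f'u m : fps0 f^`().[u m] = d by rewrite /d -!horner_map /= u0 fps0C.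
have fu m : exists z, f.[u m] = fpsX k ^+ m.+1 * z.
  elim: m => [|m [z Ez]]; first by eexists; rewrite expr1; exact: fps0_eq0.
  have [b] := taylor (u m) (- (fpsX k ^+ m.+1 * fpsC (fcoef f.[u m] m.+1 / d))).
  rewrite -/(step m (u m)) -/(u m.+1) => ->; set g := fcoef _ _.
  have gz : g = fps0 z by rewrite /g Ez fcoefXnM ltnn subnn.
  (* [z'] is the cofactor of s^(m+1) in f(u_(m+1)). Its constant term is g - d (g / d) = 0, which
     gains one more power of s. *)
  pose z' := z - f^`().[u m] * fpsC (g / d) + fpsX k ^+ m.+1 * (fpsC (g / d) ^+ 2 * b).
  have z'0 : fps0 z' = 0.
    rewrite /z' rmorphD rmorphB !rmorphM rmorphXn /= fps0X expr0n mul0r addr0.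
    rewrite f'u !fps0C gz. by rewrite mulrCA divff // mulr1 subrr.
  exists (fps_shift 1 z').
  rewrite [RHS](_ : _ = fpsX k ^+ m.+1 * z'); last by rewrite exprSr -mulrA -fps0_eq0.
  rewrite Ez /z'.
  rewrite mulrN sqrrN exprMn mulrDr mulrBr; congr (_ - _ + _); first by rewrite mulrCA.
  by rewrite [_ ^+ 2]expr2 !mulrA.
(* The limit is read off the diagonal, since coefficient i is final from step i on. *)
pose a : fps := Fps (fun i => fcoef (u i) i).
have au m i : (i <= m)%N -> fcoef a i = fcoef (u m) i.
  elim: m => [|m IH]; first by rewrite leqn0 => /eqP ->.
  rewrite leq_eqVlt => /orP[/eqP -> //|im]; rewrite IH //.
  have -> : fcoef (u m.+1) i = fcoef (u m) i -
    fcoef (fpsX k ^+ m.+1 * fpsC (fcoef f.[u m] m.+1 / d)) i by [].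
  by rewrite fcoefXnM im subr0.
exists a; first exact: fps0C.
(* Both f(u_i) and a - u_i are divisible by s^(i+1), so coefficient i of f(a) vanishes. *)
apply: fpsP => i; have [z Ez] := fu i.
have /fps_shiftK Ea : forall j, (j < i.+1)%N -> fcoef (a - u i) j = 0.
  move=> j ji; have -> : fcoef (a - u i) j = fcoef a j - fcoef (u i) j by [].
  by rewrite (au i) ?subrr.
have [b] := taylor (u i) (a - u i); rewrite addrC subrK => ->.
rewrite Ea Ez exprMn expr2 -mulrA mulrCA -!mulrA -!mulrDr fcoefXnM ltnSn.
by rewrite /= coef0.
Qed.

(** The inverse is the Hensel root of the linear polynomial a Y - 1. *)
Lemma fps_unit (a : fps) : fps0 a != 0 -> exists b, a * b = 1.
Proof.
move=> a0; have [||b _] := @hensel (a *: 'X - 1) (fps0 a)^-1.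
- by rewrite !hornerE rmorphB rmorphM rmorph1 /= fps0C divff // subrr.
- by rewrite derivB derivZ derivX derivC !hornerE ?subr0 ?mulr1.
by rewrite !hornerE => /eqP; rewrite subr_eq0 => /eqP; exists b.
Qed.
End Hensel.

(** * Expansion of the function field at a point of the affine curve *)

Lemma mmap_comp (R S : nzRingType) (T : nzRingType) n (f : {rmorphism R -> S})
    (g : {rmorphism S -> T}) (v : 'I_n -> S) (p : {mpoly R[n]}) :
  mmap (g \o f) (g \o v) p = g (mmap f v p).
Proof.
rewrite /mmap rmorph_sum; apply: eq_bigr => m _.
rewrite rmorphM /mmap1 rmorph_prod; congr (_ * _); apply: eq_bigr => i _.
by rewrite rmorphXn.
Qed.

Lemma eq_mmap (R S : nzRingType) n (f g : R -> S) (v w : 'I_n -> S)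
    (p : {mpoly R[n]}) : f =1 g -> v =1 w -> mmap f v p = mmap g w p.
Proof.
move=> fg vw; rewrite /mmap; apply: eq_bigr => m _; rewrite fg; congr (_ * _).
by apply: eq_bigr => i _; rewrite vw.
Qed.

Lemma mmap_homog (R : nzRingType) (S : comNzRingType) n d (f : R -> S) (c : S)
    (v : 'I_n -> S) (p : {mpoly R[n]}) : p \is d.-homog ->
  mmap f (fun i => c * v i) p = c ^+ d * mmap f v p.
Proof.
move/dhomogP => pd; rewrite /mmap mulr_sumr big_seq [RHS]big_seq.
apply: eq_bigr => m /pd <-; rewrite mulrCA; congr (_ * _).
rewrite /mmap1 /= mdegE -prodrXr -big_split; apply: eq_bigr => i _.
by rewrite exprMn.
Qed.

Lemma tofrac_inj (R : idomainType) : injective (@tofrac R).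
Proof. by move=> x y /eqP; rewrite tofrac_eq => /eqP. Qed.

Lemma fractionP (R : idomainType) (c : {fraction R}) :
  exists n d : R, d != 0 /\ c = tofrac n / tofrac d.
Proof.
elim/quotW: c => x; exists \n_x, \d_x; split; first exact: denom_ratioP.
have d0 : tofrac \d_x != 0 by rewrite tofrac_eq0 denom_ratioP.
apply: (mulIf d0); rewrite divfK //; unlock FracField.tofrac.
rewrite -[LHS]FracField.pi_mul; apply/eqmodP.
rewrite /= FracField.equivfE /FracField.mulf /=.
by rewrite !numden_Ratio ?mulf_neq0 ?denom_ratioP ?oner_neq0 // !mulr1 mulrC.
Qed.

Lemma map_poly_den (R : idomainType) (P : {poly {fraction R}}) :
  exists2 d : R, d != 0 & exists b, (tofrac d)%:P * P = map_poly (@tofrac R) b.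
Proof.
elim/poly_ind: P => [|p c [d d0 [b Eb]]].
  by exists 1; [exact: oner_neq0 | exists 0; rewrite mulr0 rmorph0].
have [n [e [e0 ->]]] := fractionP c.
exists (d * e); first exact: mulf_neq0.
exists (e%:P * (b * 'X) + (d * n)%:P).
rewrite (rmorphD (map_poly _)) !(rmorphM (map_poly _)) /= !map_polyC map_polyX.
rewrite /= -Eb tofracM polyCM mulrDr; congr (_ + _).
  by rewrite -!mulrA mulrCA.
rewrite -!polyCM tofracM -mulrA; congr (_ * _)%:P.
by rewrite mulrC divfK ?tofrac_eq0.
Qed.

(** * The formal branch at a point (x0, y0) of D y^r = N *)

Section Place.

Variables (k : fieldType) (r : nat) (N D : {poly k}) (x0 y0 : k).
Hypotheses (r0 : r%:R != 0 :> k) (Dx0 : D.[x0] != 0)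
  (Nx0 : N.[x0] = D.[x0] * y0 ^+ r) (y0_neq0 : y0 != 0).

Definition taylor_at (p : {poly k}) : fps k := fps_of_poly (p \Po ('X + x0%:P)).
HB.instance Definition _ := GRing.RMorphism.copy taylor_at
  (@fps_of_poly k \o (comp_poly ('X + x0%:P))).

Lemma fps0_taylor_at p : fps0 (taylor_at p) = p.[x0].
Proof.
by rewrite /fps0 /taylor_at /= -horner_coef0 horner_comp !hornerE ?add0r.
Qed.

Lemma taylor_atX : taylor_at 'X = fpsX k + fpsC x0.
Proof. by rewrite /taylor_at comp_polyX rmorphD. Qed.

Lemma taylor_at_eq0 p : taylor_at p = 0 -> p = 0.
Proof.
move=> p0; have : p \Po ('X + x0%:P) = 0.
  by apply/polyP => i; rewrite -[LHS]/(fcoef (taylor_at p) i) p0.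
move/(congr1 (fun q => q \Po ('X - x0%:P))).
by rewrite -comp_polyA comp_polyD comp_polyX comp_polyC subrK comp_polyXr comp_poly0.
Qed.

(** Hensel's lemma applies to D Y^r - N at y0: the derivative there has constant term r D(x0)
    y0^(r-1), which is nonzero. *)
Lemma root_branch : exists2 eta : fps k,
  fps0 eta = y0 & taylor_at D * eta ^+ r = taylor_at N.
Proof.
have rn0 : (0 < r)%N by rewrite lt0n; apply: contraNneq r0 => ->.
have [||eta eta0] := @hensel k ((taylor_at D)%:P * 'X^r - (taylor_at N)%:P) y0.
- rewrite !hornerE rmorphB rmorphM rmorphXn /= fps0C !fps0_taylor_at Nx0 subrr //.
- rewrite derivB derivM !derivC derivXn !hornerE hornerMn hornerXn.
  rewrite subr0 rmorphM rmorphMn rmorphXn /= fps0C fps0_taylor_at.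
  by rewrite mulf_neq0 // -mulr_natl mulf_neq0 ?expf_neq0.
by rewrite !hornerE => /eqP; rewrite subr_eq0 => /eqP; exists eta.
Qed.

Variable eta : fps k.
Hypothesis eta_root : taylor_at D * eta ^+ r = taylor_at N.

(** Substitution of x0 + s for x and [eta] for y. It is defined on polynomials only, as rational
    functions may have a pole at the point; denominators are cleared first. *)
Definition branch_at (b : {poly {poly k}}) : fps k := (map_poly taylor_at b).[eta].
HB.instance Definition _ := GRing.RMorphism.copy branch_at
  (horner_eval eta \o map_poly taylor_at).

Local Notation g := ('X^r - (tofrac N / tofrac D)%:P : {poly ratfun k}).

Definition to_ratfun_ring (b : {poly {poly k}}) : {poly %/ g} :=
  in_qpoly g (map_poly (@tofrac {poly k}) b).
HB.instance Definition _ := GRing.RMorphism.copy to_ratfun_ring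
  (in_qpoly g \o map_poly (@tofrac {poly k})).


Hypothesis r_gt0 : (0 < r)%N.

Lemma mk_monic_superelliptic : mk_monic g = g.
Proof. by rewrite /mk_monic size_XnsubC // monicXnsubC // ltnS r_gt0. Qed.

(** Pseudo-division of [b] by G = D y^r - N leaves a remainder of degree below r that vanishes in
    the quotient ring, hence is 0. So a power of D times [b] is a multiple of G, which the branch
    kills, and D is a unit in k[[s]] because D(x0) is nonzero. *)
Lemma branch_at_eq0 b : to_ratfun_ring b = 0 -> branch_at b = 0.
Proof.
have Dn0 : D != 0 by apply: contraNneq Dx0 => ->; rewrite horner0.
have DFn0 : tofrac D != 0 by rewrite tofrac_eq0.
pose G : {poly {poly k}} := D *: 'X^r - N%:P.
have mapG : map_poly (@tofrac {poly k}) G = tofrac D *: g.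
  rewrite rmorphB /= map_polyZ map_polyXn map_polyC /= scalerBr.
  by congr (_ - _); rewrite -mul_polyC -polyCM mulrC divfK.
have sG : size G = r.+1.
  rewrite -(size_map_inj_poly (tofrac_inj (R:={poly k}))) ?tofrac0 // mapG.
  by rewrite size_scale // size_XnsubC.
have gG : to_ratfun_ring G = 0.
  rewrite /to_ratfun_ring mapG linearZ /=; apply/val_inj => /=.
  by rewrite mk_monic_superelliptic Pdiv.RingMonic.rmodpp ?scaler0 // monicXnsubC.
have lG : lead_coef G = D.
  rewrite lead_coefE sG coefB coefZ coefXn eqxx mulr1 coefC.
  by rewrite gtn_eqF // subr0.
have bG : branch_at G = 0.
  rewrite /branch_at /G rmorphB /= map_polyZ map_polyXn map_polyC /=.
  by rewrite !hornerE eta_root subrr.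
move=> b0; have Eb := Pdiv.Idomain.divp_eq b G.
set Q := divp b G in Eb; set R := modp b G in Eb.
have R0 : R = 0.
  have sR : (size R < r.+1)%N by rewrite -sG ltn_modp -size_poly_gt0 sG.
  have : to_ratfun_ring R = 0.
    have := congr1 to_ratfun_ring Eb.
    rewrite -mul_polyC (rmorphD to_ratfun_ring) !(rmorphM to_ratfun_ring) /=.
    by rewrite b0 gG !mulr0 add0r.
  move/(congr1 val).
  rewrite /= Pdiv.CommonRing.rmodp_small ?mk_monic_superelliptic; last first.
    by rewrite size_XnsubC // size_map_inj_poly ?tofrac0 //; exact: tofrac_inj.
  move/eqP; rewrite -size_poly_eq0 size_map_inj_poly ?tofrac0 //.
    by rewrite size_poly_eq0 => /eqP.
  exact: tofrac_inj.
have := congr1 branch_at Eb; rewrite R0 addr0 rmorphM /= bG mulr0 lG.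
have [|c Dc] := @fps_unit k (taylor_at D); first by rewrite fps0_taylor_at.
rewrite -mul_polyC rmorphM /= [X in X * _]/branch_at map_polyC /= hornerC rmorphXn.
move/(congr1 ( *%R (c ^+ scalp b G))).
by rewrite mulr0 mulrA -exprMn mulrC [c * _]mulrC Dc expr1n mulr1.
Qed.

Lemma to_ratfun_ring_den (z : {poly %/ g}) :
  exists2 d : {poly k}, d != 0 & exists b, to_ratfun_ring d%:P * z = to_ratfun_ring b.
Proof.
have [d d0 [b Eb]] := map_poly_den (val z).
exists d => //; exists b; rewrite /to_ratfun_ring -Eb map_polyC in_qpolyM.
congr (_ * _); apply/val_inj; rewrite /=.
by rewrite Pdiv.CommonRing.rmodp_small //; exact: size_mk_monic.
Qed.
End Place.

Lemma fps_neq0P (k : comNzRingType) (a : fps k) : a != 0 -> exists i, fcoef a i != 0.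
Proof.
move=> a0; apply: boolp.contrapT => na; case/eqP: a0; apply: fpsP => i.
rewrite /= coef0; apply/eqP/negPn/negP => ai; case: na; by exists i.
Qed.

(** This is the properness of projective space over k[[s]]: with the largest common power of s
    removed, the vector has a nonzero value at s = 0. *)
Lemma fps_vec_order (k : comNzRingType) (I : finType) (q : I -> fps k) j0 :
  q j0 != 0 ->
  exists m, exists2 p : I -> fps k,
    forall j, q j = fpsX k ^+ m * p j & exists j, fps0 (p j) != 0.
Proof.
move=> /fps_neq0P[i0 qi0].
have ex : exists i, [exists j, fcoef (q j) i != 0].
  by exists i0; apply/existsP; exists j0.
case: (ex_minnP ex) => m /existsP[j qj] mmin; exists m.
exists (fun j => fps_shift m (q j)); last by exists j; rewrite /fps0 /= add0n.
move=> l; apply: fps_shiftK => i im; apply/eqP/negPn/negP => qi.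
have : (m <= i)%N by apply: mmin; apply/existsP; exists l.
by rewrite leqNgt im.
Qed.

(** * Transport of the branch to a smooth model *)

Section Branch.
Variables (k : fieldType) (r : nat) (N D : {poly k}) (X : projScheme k).
Local Notation g := ('X^r - (tofrac N / tofrac D)%:P : {poly ratfun k}).
Local Notation n := (ps_dim X).
Local Notation iota := (polyC \o polyC : k -> {poly {poly k}}).
Hypotheses (r_gt0 : (0 < r)%N) (r0 : r%:R != 0 :> k).

Lemma to_ratfun_ringC (q : {poly k}) :
  to_ratfun_ring r N D q%:P = qpolyC g (tofrac q).
Proof.
apply/val_inj; rewrite /= map_polyC /= Pdiv.CommonRing.rmodp_small //.
by rewrite (leq_ltn_trans (size_polyC_leq1 _)) // size_mk_monic_gt1.
Qed.

(** The quotient B / C expresses the function x in homogeneous coordinates. It is chosen before (x0,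
    y0), so that one and the same function can be compared along branches at different points. *)
Lemma model_branch :
  is_ratfun_ring X (qpolyC g \o @ratC k) ->
  exists d, exists B C : {mpoly k[n.+1]},
  [/\ B \is d.-homog, C \is d.-homog & forall x0 y0,
    D.[x0] != 0 -> N.[x0] = D.[x0] * y0 ^+ r -> y0 != 0 ->
  exists p : 'I_n.+1 -> fps k,
  [/\ forall G, G \in ps_eqs X -> mmap (@fpsC k) p G = 0,
      exists j, fps0 (p j) != 0,
      (fpsX k + fpsC x0) * mmap (@fpsC k) p C = mmap (@fpsC k) p B
    & mmap (@fpsC k) p C != 0]].
Proof.
pose pi : {rmorphism {poly {poly k}} -> {poly %/ g}} := to_ratfun_ring r N D.
case=> phi [phiX _ phigen].
have [d [B [C [w [Bd Cd wC xwB]]]]] := phigen (qpolyC g (ratX k)).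
exists d, B, C; split=> // x0 y0 Dx0 Nx0 y00.
have [dn dn0 /fin_all_exists[ps Eps]] := fin_all_exists2
  (fun j => to_ratfun_ring_den (phi j)).
have [e e0 [om Eom]] := to_ratfun_ring_den w.
(* A common denominator: [psi] lifts the generic point, rescaled by [dl], to k[x][y]. *)
pose dl := \prod_j dn j.
have dl0 : dl != 0 by apply/prodf_neq0 => j _.
pose psi j := (\prod_(i | i != j) dn i)%:P * ps j.
have Epsi j : pi (psi j) = pi dl%:P * phi j.
  rewrite /psi (rmorphM pi) /= -Eps mulrA -(rmorphM pi) -polyCM; congr (pi _%:P * _).
  by rewrite /dl [RHS](bigD1 j) //= mulrC.
have piM m G : G \is m.-homog -> pi (mmap iota psi G) =
    pi dl%:P ^+ m * mmap (qpolyC g \o @ratC k) phi G.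
  move=> Gm; rewrite -(mmap_homog _ _ _ Gm) -(mmap_comp iota pi).
  by apply: eq_mmap => [c|j] /=; rewrite ?Epsi // /pi /= to_ratfun_ringC.
have xE : pi ('X%:P) = qpolyC g (ratX k) by rewrite /pi /= to_ratfun_ringC.
have [eta eta0 eta_root] := root_branch r0 Dx0 Nx0 y00.
pose th : {rmorphism {poly {poly k}} -> fps k} := branch_at x0 eta.
have thM G : th (mmap iota psi G) = mmap (@fpsC k) (fun j => th (psi j)) G.
  rewrite -(mmap_comp iota th); apply: eq_mmap => c //=.
  by rewrite /th /= /branch_at map_polyC hornerC /= /taylor_at comp_polyC.
have thC q : th q%:P = taylor_at x0 q by rewrite /th /= /branch_at map_polyC hornerC.
have th0 b : pi b = 0 -> th b = 0 by exact: branch_at_eq0.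
pose q j := th (psi j).
have qX G : G \in ps_eqs X -> mmap (@fpsC k) q G = 0.
  move=> GX; have /homogP[m Gm] := allP (ps_homog X) _ GX.
  by rewrite -thM th0 // (piM _ _ Gm) phiX // mulr0.
have qBC : (fpsX k + fpsC x0) * mmap (@fpsC k) q C = mmap (@fpsC k) q B.
  apply/eqP; rewrite -subr_eq0 -!thM -taylor_atX -thC -(rmorphM th) -(rmorphB th).
  apply/eqP/th0; rewrite (rmorphB pi) (rmorphM pi) /= xE !(piM d) // xwB.
  by rewrite mulrCA -mulrBr mulrAC wC mul1r subrr mulr0.
(* Since [w] inverts C at the generic point, C(q) divides the expansion of the nonzero polynomial e
   dl^d. *)
have qC : mmap (@fpsC k) q C != 0.
  have thoC : th om * mmap (@fpsC k) q C = taylor_at x0 (e * dl ^+ d).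
    apply/eqP; rewrite -subr_eq0 -thM -thC -(rmorphM th) -(rmorphB th).
    apply/eqP/th0; rewrite (rmorphB pi) (rmorphM pi) /= -Eom (piM d) //.
    rewrite mulrACA wC mulr1 -(rmorphXn pi) -(rmorphM pi) -(rmorphXn polyC) -polyCM.
    by rewrite subrr.
  apply/eqP => C0; move: thoC; rewrite C0 mulr0 => /esym/taylor_at_eq0/eqP.
  by rewrite mulf_eq0 expf_eq0 (negPf e0) (negPf dl0) andbF.
(* If q were 0, then B(q) and C(q) would be constants b and c with (s + x0) c = b, and the
   coefficient of s would give c = 0. *)
have [j0 qj0] : exists j, q j != 0.
  apply: boolp.contrapT => nq; have q0 j : q j = 0.
    by apply/eqP/negPn/negP => qj; case: nq; exists j.
  have evC G : mmap (@fpsC k) q G = fpsC (mmap idfun (fun _ => 0) G).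
    rewrite -(mmap_comp _ (@fpsC k)); apply: eq_mmap => [//|j].
    by rewrite /= q0 rmorph0.
  move: qBC qC; rewrite !evC; set b := mmap _ _ B; set c := mmap _ _ C => bc.
  suff -> : c = 0 by rewrite rmorph0 eqxx.
  have : fcoef ((fpsX k + fpsC x0) * fpsC c) 1 = fcoef (fpsC b) 1 by rewrite bc.
  rewrite /fpsX /fpsC -(rmorphD (@fps_of_poly k)) -(rmorphM (@fps_of_poly k)) /=.
  by rewrite coefMC coefD coefX !coefC /= addr0 mul1r.
have [m [p qp p0]] := fps_vec_order qj0.
have qpM t G : G \is t.-homog ->
    mmap (@fpsC k) q G = (fpsX k ^+ m) ^+ t * mmap (@fpsC k) p G.
  by move=> Gt; rewrite -(mmap_homog _ _ _ Gt); apply: eq_mmap.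
exists p; split=> // [G GX||].
- have /homogP[t Gt] := allP (ps_homog X) _ GX.
  apply: (@fpsXn_inj k (m * t)); rewrite mulr0 exprM -(qpM _ _ Gt).
  exact: qX.
- apply: (@fpsXn_inj k (m * d)); rewrite exprM mulrCA -!(qpM d) //.
by apply: contraNneq qC => Cp0; rewrite (qpM d) // Cp0 mulr0.
Qed.
End Branch.

(** * Branches through a smooth point *)

Section Hadamard.
Variables (k : comNzRingType) (n : nat) (P : 'I_n -> k).
Local Notation ev := (mmap idfun P).

(** Hadamard's form of Taylor's formula. The remainder is absorbed into the H_j, so the identity is
    exact and can be evaluated along any power series. *)
Definition hadamard_at (Q : {mpoly k[n]}) := exists H : 'I_n -> {mpoly k[n]},
  Q = (ev Q)%:MP + \sum_j H j * ('X_j - (P j)%:MP) /\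
  forall j, ev (H j) = ev (mderiv j Q).

Lemma hadamard_atC c : hadamard_at c%:MP.
Proof.
exists (fun=> 0); split=> [|j]; last by rewrite mderivC.
by rewrite big1 ?addr0 ?mmapC // => j _; rewrite mul0r.
Qed.

Lemma hadamard_atX i : hadamard_at 'X_i.
Proof.
exists (fun j => (i == j)%:R); split=> [|j].
  rewrite (bigD1 i) //= eqxx mul1r big1 ?addr0 => [|j ji]; last first.
    by rewrite eq_sym (negPf ji) mul0r.
  by rewrite mmapX mmap1U addrC subrK.
rewrite mderivX mnm1E rmorph_nat; case: eqP => [->|_]; last first.
  by rewrite mulr0n scale0r rmorph0.
have -> : (U_(j) - U_(j) = 0)%MM by apply/mnmP => l; rewrite mnmBE mnm0E subnn.
by rewrite mulr1n scale1r mpolyX0 rmorph1.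
Qed.

Lemma hadamard_atD Q1 Q2 : hadamard_at Q1 -> hadamard_at Q2 -> hadamard_at (Q1 + Q2).
Proof.
move=> [H1 [E1 D1]] [H2 [E2 D2]]; exists (fun j => H1 j + H2 j); split=> [|j].
  rewrite {1}E1 {1}E2 rmorphD mpolyCD addrACA -big_split; congr (_ + _).
  by apply: eq_bigr => j _; rewrite mulrDl.
by rewrite mderivD !rmorphD /= D1 D2.
Qed.

Lemma hadamard_atM Q1 Q2 : hadamard_at Q1 -> hadamard_at Q2 -> hadamard_at (Q1 * Q2).
Proof.
move=> [H1 [E1 D1]] [H2 [E2 D2]].
exists (fun j => H1 j * Q2 + (ev Q1)%:MP * H2 j); split=> [|j].
  rewrite {1}E1 mulrDl {1}E2 mulrDr rmorphM mpolyCM -addrA; congr (_ + _).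
  rewrite mulr_sumr mulr_suml -big_split; apply: eq_bigr => j _.
  by rewrite /= mulrDl mulrA addrC mulrAC.
by rewrite mderivM !(rmorphD, rmorphM) /= D1 D2 mmapC.
Qed.

(** Polynomials with such an expansion include constants and variables and are closed under sums and
    products. *)
Lemma hadamard Q : hadamard_at Q.
Proof.
rewrite [Q]mpolyE; elim/big_ind: _ => [||m _].
- by rewrite -mpolyC0; apply: hadamard_atC.
- exact: hadamard_atD.
rewrite -mul_mpolyC; apply: hadamard_atM; first exact: hadamard_atC.
rewrite mpolyXE_id; elim/big_ind: _ => [||i _].
- by rewrite -mpolyC1; apply: hadamard_atC.
- exact: hadamard_atM.
elim: (m i) => [|e IH]; first by rewrite expr0 -mpolyC1; apply: hadamard_atC.
by rewrite exprS; apply: hadamard_atM => //; apply: hadamard_atX.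
Qed.
End Hadamard.

(** Compares two factorizations through powers of u. In both uses the bracket has nonzero constant
    term, which forces u^m = 0. *)
Lemma expr_cross_cancel (R : comNzRingType) (u a b c d r1 r2 : R) m e :
    c = u ^+ m * r1 -> d = u ^+ (e + m) * r2 -> a * c = b * d ->
  u ^+ m * (a * r1 - b * r2 * u ^+ e) = 0.
Proof.
move=> -> ->; rewrite exprD => E.
have -> : u ^+ m * (a * r1 - b * r2 * u ^+ e) =
    a * (u ^+ m * r1) - b * (u ^+ e * u ^+ m * r2) by ring.
by rewrite E subrr.
Qed.

Local Opaque mmap fps_mul fps_add fps_opp fps_of_poly fpsC.

(** * Local parameter at a smooth rational point *)

Section SmoothPoint.
Variables (k : fieldType) (X : projScheme k).
Local Notation n := (ps_dim X).
Local Notation ev v := (mmap (@fpsC k) v).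
Variables (P : 'I_n.+1 -> k) (j0 : 'I_n.+1).
Hypotheses (XP : @is_point k X k idfun (\row_j P j)) (smX : smooth_curve X)
  (Pj0 : P j0 = 1).

Lemma fps0_ev (v : 'I_n.+1 -> fps k) Q : fps0 (ev v Q) = mmap idfun (fps0 (k:=k) \o v) Q.
Proof.
rewrite -(mmap_comp _ (@fps0 k)); apply: eq_mmap => // c /=.
by rewrite fps0C.
Qed.

(** A formal arc on X centred at P, normalized to the affine chart where coordinate [j0] equals
    1. *)
Definition branch (v : 'I_n.+1 -> fps k) := 
  [/\ forall G, G \in ps_eqs X -> ev v G = 0, forall j, fps0 (v j) = P j & v j0 = 1].

Lemma eqs_at G : G \in ps_eqs X -> mmap idfun P G = 0.
Proof.
move=> GX; case: XP => _ /(_ _ GX) <-; apply: eq_mmap => // j.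
by rewrite mxE.
Qed.

(* Euler's relation, read off the first-order term of G((1 + s) P) = (1 + s)^d G(P). *)
Lemma euler G : G \in ps_eqs X -> \sum_j mmap idfun P (mderiv j G) * P j = 0.
Proof.
move=> GX; have /homogP[d Gd] := allP (ps_homog X) _ GX.
have [H [EG DG]] := hadamard P G.
pose v j := (1 + fpsX k) * fpsC (P j).
have v0 j : fps0 (v j) = P j.
  by rewrite /v rmorphM rmorphD rmorph1 /= fps0X fps0C addr0 mul1r.
have := mmap_homog (@fpsC k) (1 + fpsX k) (fun j => fpsC (P j)) Gd.
have -> : mmap (@fpsC k) (fun j => fpsC (P j)) G = 0.
  by rewrite -[RHS](rmorph0 (@fpsC k)) -(eqs_at GX) -(mmap_comp _ (@fpsC k)).
rewrite mulr0 -/v {1}EG eqs_at // rmorphD rmorph0 rmorph_sum add0r => Ev.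
rewrite -[RHS](rmorph0 (@fps0 k)) -[0 in RHS](_ : \sum_j ev v (H j) * fpsC (P j) = 0).
  rewrite rmorph_sum; apply: eq_bigr => j _; rewrite rmorphM /= fps0C fps0_ev -DG.
  by congr (_ * _); apply: eq_mmap => // i; rewrite /= v0.
apply: (@fpsXn_inj k 1); rewrite mulr0 -[RHS]Ev expr1 mulr_sumr.
apply: eq_bigr => j _; rewrite rmorphM rmorphB /= mmapC mmapX mmap1U.
by rewrite mulrCA; congr (_ * _); rewrite /v mulrDl mul1r addrC addKr.
Qed.

(** A complement of the row space of K has rank at most 1, so one row t spans it. This row supplies
    the linear form of the local parameter. *)
Lemma row_complement s (K : 'M[k]_(s, n.+1)) : (n <= \rank K)%N ->
  exists (t : 'rV[k]_n.+1) (L : 'M[k]_(n.+1, s)) (c : 'cV[k]_n.+1),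
    L *m K + c *m t = 1%:M.
Proof.
move=> rK; exists (nz_row K^C%MS).
suff /sub_addsmxP[[L c] /= ->] : (1%:M <= K + nz_row K^C)%MS by exists L, c.
apply: (@submx_trans _ _ _ _ _ _ (K + K^C)%MS); first by rewrite sub1mx addsmx_compl_full.
apply: addsmxS => //; have [->|nz] := eqVneq K^C%MS 0; first exact: sub0mx.
have [_ <-] := mxrank_leqif_sup (nz_row_sub K^C%MS).
rewrite rank_rV nz_row_eq0 nz eqn_leq lt0n mxrank_eq0 nz /=.
by rewrite mxrank_compl leq_subLR addn1 ltnS.
Qed.

(** Nakayama's lemma made explicit: [u] generates the maximal ideal at P up to a multiplier E with
    E(P) = 1. Hadamard expansions lift the Jacobian to a polynomial matrix A with A(P) = 1, and the
    adjugate of A solves for the X_j - P_j. E and R serve all branches at once. *)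
Lemma local_parameter : exists2 u : {mpoly k[n.+1]}, mmap idfun P u = 0 &
  forall Q, mmap idfun P Q = 0 -> exists E R, mmap idfun P E = 1 /\
  forall v, branch v -> ev v E * ev v Q = ev v u * ev v R.
Proof.
pose s := size (ps_eqs X).
pose J := jacobian (X:=X) idfun (\row_j P j).
pose G (i : 'I_s) := (ps_eqs X)`_i.
have GX i : G i \in ps_eqs X by apply: mem_nth.
have JE i j : J i j = mmap idfun P (mderiv j (G i)).
  by rewrite mxE; apply: eq_mmap => // l; rewrite mxE.
pose e : 'rV[k]_n.+1 := delta_mx 0 j0.
have JP : J *m \col_j P j = 0.
  apply/matrixP => i l; rewrite !mxE -[RHS](euler (GX i)).
  by apply: eq_bigr => j _; rewrite JE mxE.
(* J has rank n - 1 by smoothness. By Euler's relation J kills P, whereas e P = P_j0 = 1, so [e] is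
   independent of the rows of J. *)
have rK : (n <= \rank (col_mx J e))%N.
  have rJ : (\rank J).+1 = n := smX XP.
  apply: (@leq_trans (\rank J).+1); first by rewrite rJ.
  apply: rank_ltmx; rewrite /ltmx -addsmxE addsmxSl /=.
  apply/negP; rewrite col_mx_sub => /andP[_ /submxP[Z eZ]].
  have : (e *m \col_j P j) 0 0 = 1.
    rewrite mxE (bigD1 j0) //= !mxE !eqxx mul1r Pj0 big1 ?addr0 // => j jj0.
    by rewrite !mxE (negPf jj0) andbF mul0r.
  by rewrite eZ -mulmxA JP mulmx0 mxE => /esym/eqP; rewrite oner_eq0.
have [t [L [c LKct]]] := row_complement rK.
have [H EH] := fin_all_exists (fun i => hadamard P (G i)).
pose mC := @mpolyC n.+1 k.
pose V : 'cV[{mpoly k[n.+1]}]_n.+1 := \col_j ('X_j - mC (P j)).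
pose K := col_mx (\matrix_(i, j) H i j) (map_mx mC e).
pose A := map_mx mC L *m K + map_mx mC c *m map_mx mC t.
pose u := (map_mx mC t *m V) 0 0.
have evmC a b (M : 'M[k]_(a, b)) : map_mx (mmap idfun P) (map_mx mC M) = M.
  by apply/matrixP => i j; rewrite !mxE mmapC.
have evA : map_mx (mmap idfun P) A = 1%:M.
  rewrite map_mxD !map_mxM !evmC map_col_mx evmC -LKct; congr (_ *m col_mx _ _ + _).
  apply/matrixP => i j; rewrite JE; case: (EH i) => _ <-.
  by rewrite [LHS]mxE; congr (mmap _ _ _); rewrite mxE.
have AV : A *m V = map_mx mC L *m (K *m V) + map_mx mC c *m u%:M.
  by rewrite mulmxDl -!mulmxA -mx11_scalar.
(* The upper rows of K V are the G_i, because G_i(P) = 0; the last one is X_j0 - P_j0. All vanish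
   along a branch. *)
have KV v (l : 'I_(s + 1)) : branch v -> ev v ((K *m V) l 0) = 0.
  case=> vX v0 vj0; rewrite mul_col_mx.
  case: (splitP l) => [i|i] li.
    have -> : l = lshift 1 i by apply: val_inj.
    rewrite col_mxEu mxE (eq_bigr (fun j => H i j * ('X_j - (P j)%:MP))).
      case: (EH i) => EG _; have := vX _ (GX i); rewrite {1}EG.
      by rewrite eqs_at ?GX // mpolyC0 add0r.
    by move=> j _; rewrite !mxE.
  have -> : l = rshift s i by apply: val_inj.
  rewrite col_mxEd mxE (bigD1 j0) //= !mxE !ord1 !eqxx big1 => [|j jj0].
    rewrite addr0 rmorphM rmorphB /= /mC !mmapC mmapX mmap1U vj0 Pj0 rmorph1.
    by rewrite subrr mulr0.
  by rewrite !mxE (negPf jj0) andbF /mC mpolyC0 mul0r.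
pose R := \adj A *m map_mx mC c.
have AVR : \det A *: V = \adj A *m map_mx mC L *m (K *m V) + u *: R.
  rewrite -mul_scalar_mx -mul_adj_mx -[LHS]mulmxA AV mulmxDr /R -mul_mx_scalar !mulmxA.
  reflexivity.
have EV v j : branch v -> ev v (\det A) * (v j - fpsC (P j)) = ev v u * ev v (R j 0).
  move=> bv; have <- : ev v (V j 0) = v j - fpsC (P j).
    by rewrite mxE rmorphB /= mmapX mmap1U /mC mmapC.
  rewrite -!rmorphM /= [_ * _ in LHS](_ : _ = (\det A *: V) j 0); last first.
    by rewrite [RHS]mxE.
  rewrite AVR [X in ev v X]mxE [X in X + _]mxE rmorphD /= rmorph_sum.
  rewrite big1 ?add0r => [|l _].
    by rewrite [in LHS]mxE.
  by rewrite rmorphM /= KV ?mulr0.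
have detP : mmap idfun P (\det A) = 1 by rewrite -det_map_mx evA det1.
move: (\det A) EV detP => dA EV dAP {AVR}.
exists u.
  rewrite /u mxE rmorph_sum big1 // => j _; rewrite !mxE !(rmorphM, rmorphB) /=.
  by rewrite /mC !mmapC mmapX mmap1U subrr mulr0.
move=> Q QP; have [h [EQ _]] := hadamard P Q.
exists dA, (\sum_j h j * R j 0); split; first exact: dAP.
move=> v bv; rewrite {1}EQ QP mpolyC0 add0r !rmorph_sum !mulr_sumr.
apply: eq_bigr => j _; rewrite !rmorphM rmorphB /= mmapX mmap1U mmapC.
by rewrite /= mulrCA (EV _ _ bv) mulrCA.
Qed.

(** Division by [u] is repeated as long as the quotient vanishes at P. Nonvanishing along [v0] only
    ensures termination; the factorization obtained holds along every branch. *)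
Lemma branch_power v0 : branch v0 -> exists2 u : {mpoly k[n.+1]}, mmap idfun P u = 0 &
  forall Q, ev v0 Q != 0 -> exists m E R,
  [/\ mmap idfun P E != 0, mmap idfun P R != 0 &
      forall v, branch v -> ev v E * ev v Q = ev v u ^+ m * ev v R].
Proof.
move=> bv0; have [u uP divu] := local_parameter; exists u => // Q /fps_neq0P[i].
have ev0 v T : branch v -> fps0 (ev v T) = mmap idfun P T.
  by case=> _ vP _; rewrite fps0_ev; apply: eq_mmap.
elim/ltn_ind: i Q => i IH Q Qi.
have [QP|QP] := eqVneq (mmap idfun P Q) 0; last first.
  exists 0, 1, Q; split=> // [|v _]; first by rewrite rmorph1 oner_neq0.
  by rewrite rmorph1 expr0 !mul1r.
have [E [T [EP ET]]] := divu Q QP.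
have [c Ec] : exists c, ev v0 E * c = 1 by apply: fps_unit; rewrite ev0 // EP oner_neq0.
(* The quotient T has a nonzero coefficient below i: otherwise u T, and hence Q, would have order
   greater than i along [v0]. *)
have [i' i'i Ti'] : exists2 i', (i' < i)%N & fcoef (ev v0 T) i' != 0.
  apply: boolp.contrapT => nT; case/eqP: Qi.
  have /fps_shiftK TX : forall j, (j < i)%N -> fcoef (ev v0 T) j = 0.
    by move=> j ji; apply/eqP/negPn/negP => Tj; case: nT; exists j.
  have uX : ev v0 u = fpsX k * fps_shift 1 (ev v0 u) by apply: fps0_eq0; rewrite ev0.
  rewrite -[ev v0 Q]mul1r -Ec mulrAC ET // uX TX.
  by rewrite mulrACA -exprS -mulrA fcoefXnM ltnSn.
have [m [E' [R [E'P RP ER]]]] := IH _ i'i _ Ti'.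
exists m.+1, (E' * E), R; split=> [|//|v bv].
  by rewrite rmorphM mulf_neq0 //= EP oner_neq0.
by rewrite rmorphM /= -mulrA (ET _ bv) mulrCA (ER _ bv) mulrA -exprS.
Qed.

(** B' stands for (x - x1) C. Along [v1] it is s C, so it contains more factors u than C does. Along
    [v2], if x1 and x2 differ, it is a unit times C, so it contains equally many. *)
Lemma branches_agree v1 v2 x1 x2 (B C : {mpoly k[n.+1]}) :
  branch v1 -> branch v2 ->
  (fpsX k + fpsC x1) * ev v1 C = ev v1 B -> ev v1 C != 0 ->
  (fpsX k + fpsC x2) * ev v2 C = ev v2 B -> ev v2 C != 0 -> x1 = x2.
Proof.
move=> bv1 bv2 E1 C1 E2 C2; apply/eqP/negPn/negP => x12.
have ev0 v T : branch v -> fps0 (ev v T) = mmap idfun P T.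
  by case=> _ vP _; rewrite fps0_ev; apply: eq_mmap.
have [u uP powu] := branch_power bv1.
have u0 v : branch v -> fps0 (ev v u) = 0 by move=> bv; rewrite ev0.
pose B' := B - x1%:MP * C.
have evB' v : ev v B' = ev v B - fpsC x1 * ev v C by rewrite rmorphB rmorphM /= mmapC.
have B'1 : ev v1 B' = fpsX k * ev v1 C by rewrite evB' -E1 mulrDl addrK.
have B'2 : ev v2 B' = (fpsX k + fpsC (x2 - x1)) * ev v2 C.
  by rewrite evB' -E2 -mulrBl rmorphB addrA; reflexivity.
have B'n0 : ev v1 B' != 0.
  rewrite B'1; apply: contraNneq C1 => XC; apply/eqP/(@fpsXn_inj k 1).
  by rewrite expr1 mulr0.
have [mC [EC [RC [ECP RCP EqC]]]] := powu _ C1.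
have [mB [EB [RB [EBP RBP EqB]]]] := powu _ B'n0.
have cancel (a b : fps k) : fps0 a != 0 -> b * a = 0 -> b = 0.
  move=> /fps_unit[c ac] ba; by rewrite -[b]mulr1 -ac mulrA ba mul0r.
have swap (a b s c : fps k) : a * (b * (s * c)) = s * b * (a * c) by ring.
(* If mB were at most mC, comparing B' = s C along [v1] would give a bracket with nonzero constant
   term, hence u^mB = 0 and B' = 0 there. *)
have mCB : (mC < mB)%N.
  rewrite ltnNge; apply/negP => mBC; case/eqP: B'n0.
  apply: (@cancel (ev v1 EB)); first by rewrite ev0.
  rewrite mulrC (EqB _ bv1) [_ ^+ mB](_ : _ = 0); first exact: mul0r.
  apply: (@cancel (ev v1 EC * ev v1 RB -
                  fpsX k * ev v1 EB * ev v1 RC * ev v1 u ^+ (mC - mB))).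
    by rewrite rmorphB !rmorphM /= fps0X !mul0r subr0 !ev0 // mulf_neq0.
  have EqC1 : ev v1 EC * ev v1 C = ev v1 u ^+ (mC - mB + mB) * ev v1 RC.
    by rewrite (subnK mBC); exact: EqC.
  by apply: expr_cross_cancel (EqB _ bv1) EqC1 _; rewrite B'1; exact: swap.
(* Along [v2] the factor s + (x2 - x1) is a unit and the term with u^(mB - mC) has constant term 0.
   The bracket is again a unit, hence u^mC = 0 and C = 0 there. *)
case/eqP: C2; apply: (@cancel (ev v2 EC)); first by rewrite ev0.
rewrite mulrC (EqC _ bv2) [_ ^+ mC](_ : _ = 0); first exact: mul0r.
apply: (@cancel ((fpsX k + fpsC (x2 - x1)) * ev v2 EB * ev v2 RC -
                ev v2 EC * ev v2 RB * ev v2 u ^+ (mB - mC))).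
  rewrite rmorphB !rmorphM rmorphXn rmorphD /= fps0X fps0C add0r !ev0 // uP.
  rewrite expr0n subn_eq0 leqNgt mCB mulr0 subr0.
  by rewrite !mulf_neq0 // subr_eq0 eq_sym.
have EqB2 : ev v2 EB * ev v2 B' = ev v2 u ^+ (mB - mC + mC) * ev v2 RB.
  by rewrite (subnK (ltnW mCB)); exact: EqB.
by apply: expr_cross_cancel (EqC _ bv2) EqB2 _; rewrite B'2; exact: esym (swap _ _ _ _).
Qed.
End SmoothPoint.

(** * Rational points as values of branches at s = 0 *)

Section Specialization.
Variables (k : fieldType) (X : projScheme k).
Local Notation n := (ps_dim X).
Local Notation ev v := (mmap (@fpsC k) v).

Lemma specialization_is_point (v : 'I_n.+1 -> fps k) :
  (forall G, G \in ps_eqs X -> ev v G = 0) -> (exists j, fps0 (v j) != 0) ->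
  @is_point k X k idfun (\row_j fps0 (v j)).
Proof.
move=> vX [j vj]; split=> [|G GX].
  by apply: contraNneq vj => /rowP/(_ j); rewrite !mxE => ->.
have := fps0_ev v G; rewrite (vX G GX) rmorph0 => ->.
by apply: eq_mmap => // i; rewrite mxE.
Qed.

(** If the values were proportional, dividing each vector by its coordinate [j0], a unit series,
    would make both of them branches at one point. Homogeneity preserves the equations and, as B and
    C have equal degree, the value of B / C. *)
Lemma specializations_distinct (v1 v2 : 'I_n.+1 -> fps k) d (B C : {mpoly k[n.+1]})
    x1 x2 l :
  smooth_curve X -> B \is d.-homog -> C \is d.-homog ->
  (forall G, G \in ps_eqs X -> ev v1 G = 0) -> (exists j, fps0 (v1 j) != 0) ->
  (fpsX k + fpsC x1) * ev v1 C = ev v1 B -> ev v1 C != 0 ->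
  (forall G, G \in ps_eqs X -> ev v2 G = 0) ->
  (fpsX k + fpsC x2) * ev v2 C = ev v2 B -> ev v2 C != 0 ->
  x1 <> x2 -> \row_j fps0 (v1 j) <> l *: \row_j fps0 (v2 j).
Proof.
move=> smX Bd Cd v1X [j0 v1j0] E1 C1 v2X E2 C2 x12 /rowP vl.
have {}vl j : fps0 (v1 j) = l * fps0 (v2 j) by have := vl j; rewrite !mxE.
have [l0 v2j0] : l != 0 /\ fps0 (v2 j0) != 0.
  by move: v1j0; rewrite vl mulf_eq0 negb_or => /andP.
have [c1 vc1] := fps_unit v1j0; have [c2 vc2] := fps_unit v2j0.
have unit_neq0 (a b c : fps k) e : a * c = 1 -> b != 0 -> c ^+ e * b != 0.
  move=> ac; apply: contraNneq => cb.
  by rewrite -[b]mul1r -(expr1n _ e) -ac exprMn -mulrA cb mulr0.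
have scaled_eqs c v G : (forall G, G \in ps_eqs X -> ev v G = 0) ->
    G \in ps_eqs X -> ev (fun j => c * v j) G = 0.
  move=> vX GX; have /homogP[e Ge] := allP (ps_homog X) _ GX.
  by rewrite (mmap_homog _ _ _ Ge) vX // mulr0.
have scaled_eq c v x : (fpsX k + fpsC x) * ev v C = ev v B ->
    (fpsX k + fpsC x) * ev (fun j => c * v j) C = ev (fun j => c * v j) B.
  by move=> E; rewrite (mmap_homog _ _ _ Bd) (mmap_homog _ _ _ Cd) mulrCA E.
have c1E : fps0 c1 = (l * fps0 (v2 j0))^-1.
  apply: (mulfI v1j0); rewrite -rmorphM /= vc1 vl mulfV ?rmorph1 //.
  by rewrite -vl.
have c2E : fps0 c2 = (fps0 (v2 j0))^-1.
  by apply: (mulfI v2j0); rewrite -rmorphM /= vc2 mulfV ?rmorph1.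
apply: x12.
apply: (@branches_agree k X (fun j => fps0 (c1 * v1 j)) j0 _ smX _
  (fun j => c1 * v1 j) (fun j => c2 * v2 j) x1 x2 B C).
- apply: (@specialization_is_point (fun j => c1 * v1 j)).
    by move=> G; apply: scaled_eqs.
  by exists j0; rewrite mulrC vc1 rmorph1 oner_neq0.
- by rewrite mulrC vc1 rmorph1.
- by split=> [G||] //; [apply: scaled_eqs | rewrite mulrC].
- split=> [G|j|]; [exact: scaled_eqs | | by rewrite mulrC].
  by rewrite !rmorphM /= c1E c2E vl invfM mulrACA mulVf // mul1r.
- exact: scaled_eq.
- by rewrite (mmap_homog _ _ _ Cd) (unit_neq0 _ _ _ _ vc1).
- exact: scaled_eq.
- by rewrite (mmap_homog _ _ _ Cd) (unit_neq0 _ _ _ _ vc2).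
Qed.
End Specialization.

(** * The points on y^r = h(x) h(a/x) *)

Lemma horner_reciprocal (L : fieldType) (Q : {poly L}) (a x : L) e :
  (size Q <= e)%N -> x != 0 ->
  Q.[a / x] * x ^+ e = \sum_(i < e) Q`_i * a ^+ i * x ^+ (e - i).
Proof.
move=> Qe x0; rewrite (horner_coef_wide _ Qe) mulr_suml; apply: eq_bigr => i _.
have -> : x ^+ e = x ^+ i * x ^+ (e - i) by rewrite -exprD subnKC // ltnW.
by rewrite expr_div_n !mulrA divfK // expf_neq0.
Qed.

Lemma ratX_neq0 (k : fieldType) : ratX k != 0.
Proof. by rewrite tofrac_eq0 polyX_eq0. Qed.

Lemma ratXn_inj (k : fieldType) : injective (fun m => ratX k ^+ m).
Proof.
move=> m1 m2; rewrite /= /ratX -!rmorphXn => /tofrac_inj.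
move/(congr1 (fun p : {poly k} => size p)).
by rewrite !size_polyXn => -[].
Qed.

(** The numerator over the denominator x^(size h); the exponent is [size h], one more than the
    degree of a nonzero h. *)
Definition hha_num (F : fieldType) (h : {poly F}) (a : ratfun F) : {poly ratfun F} :=
  let H := map_poly (@ratC F) h in
  H * \sum_(i < size h) (H`_i * a ^+ i) *: 'X^(size h - i).

Lemma hhaE (F : fieldType) (h : {poly F}) (a : ratfun F) :
  hha h a = tofrac (hha_num h a) / tofrac 'X^(size h).
Proof.
rewrite /hha /hha_num map_poly_comp; set H := map_poly (@ratC F) h.
have -> : (map_poly (@ratC (ratfun F)) H).[ratX (ratfun F)] = tofrac H.
  have -> : @ratC (ratfun F) = @tofrac {poly ratfun F} \o polyC by [].
  rewrite map_poly_comp /ratX horner_map /=; congr tofrac.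
  exact: comp_polyXr.
have xn0 : ratX (ratfun F) ^+ size h != 0 by rewrite expf_neq0 ?ratX_neq0.
have xE : tofrac 'X^(size h) = ratX (ratfun F) ^+ size h :> ratfun (ratfun F).
  exact: rmorphXn.
apply: (mulIf xn0); rewrite xE divfK // -mulrA.
rewrite horner_reciprocal ?ratX_neq0 //; last first.
  by rewrite (leq_trans (size_poly _ _)) // (leq_trans (size_poly _ _)).
rewrite tofracM; congr (_ * _); rewrite rmorph_sum; apply: eq_bigr => i _.
rewrite -mul_polyC rmorphM rmorphXn /=; congr (_ * _).
by rewrite coef_map /= -rmorphXn -rmorphM.
Qed.

Lemma hha_numE (F : fieldType) (h : {poly F}) (a x : ratfun F) : x != 0 ->
  let H := map_poly (@ratC F) h in
  (hha_num h a).[x] = x ^+ size h * (H.[x] * H.[a / x]).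
Proof.
move=> x0 H; rewrite /hha_num hornerM -/H [RHS]mulrC -[RHS]mulrA; congr (_ * _).
rewrite horner_reciprocal ?size_poly // horner_sum; apply: eq_bigr => i _.
by rewrite hornerZ hornerXn.
Qed.

(** Raising to the power q^e is additive in characteristic p and fixes the coefficients of h, which
    lie in F_q. *)
Lemma horner_frobenius (F : finFieldType) (R : comNzRingType) (f : {rmorphism F -> R})
    (h : {poly F}) (x : R) p m e : prime p -> #|F| = (p ^ m)%N ->
  (map_poly f h).[x ^+ (#|F| ^ e)] = (map_poly f h).[x] ^+ (#|F| ^ e).
Proof.
move=> pp Fp; have pF := card_finPcharP Fp pp.
have nat : [pchar R].-nat (#|F| ^ e)%N.
  rewrite Fp -expnM pnatX pnatE //.
  by rewrite (rmorph_pchar f pF).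
have FF c : c ^+ (#|F| ^ e) = c :> F.
  by elim: e {nat} => // e IH; rewrite expnS exprM expf_card.
elim/poly_ind: h => [|h c IH]; first by
  rewrite rmorph0 !horner0 expr0n expn_eq0 (gtn_eqF (ltnW (finNzRing_gt1 F))).
rewrite rmorphD rmorphM /= map_polyX map_polyC !hornerE IH exprDn_pchar // exprMn.
by rewrite -rmorphXn FF.
Qed.

(** Induction through b^(2i+3) + b^2 = b^2 (b^(2i+1) + 1), since b + 1 divides b^2 - 1. *)
Lemma dvdn_odd_expn_add1 b i : (b + 1 %| b ^ (2 * i).+1 + 1)%N.
Proof.
elim: i => [|i IH]; first by rewrite muln0 expn1.
case: b IH => [|b] IH; first by rewrite add0n dvd1n.
have d : (b.+1 + 1 %| b.+1 ^ 2 - 1)%N by rewrite -[1%N](exp1n 2) subn_sqr dvdn_mull.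
rewrite -(dvdn_addl _ d) -addnA subnKC ?expn_gt0 //.
have -> : (b.+1 ^ (2 * i.+1).+1 + b.+1 ^ 2 = b.+1 ^ 2 * (b.+1 ^ (2 * i).+1 + 1))%N.
  by rewrite mulnDr muln1 -expnD mulnS addnS.
exact: dvdn_mull.
Qed.

Theorem mainTheorem1 (p m q : nat) (F : finFieldType)
  (hp : prime p) (hm : (0 < m)%N) (hq : q = (p ^ m)%N) (hF : #|F| = q)
  (r : nat) (hr : (1 < r)%N) (hrp : coprime r p)
  (h : {poly F}) (hdeg : (1 < size h)%N) (h0 : h.[0] != 0)
  (hpow : forall e : nat, (1 < e)%N -> (e %| r)%N ->
     forall g : {fraction {poly F}}, tofrac h <> g ^+ e)
  (X : {fraction {poly F}} -> projScheme {fraction {poly F}})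
  (hX : forall a : {fraction {poly F}}, nonconstant a ->
     smooth_model r (hha h a) (X a))
  (hrq : exists2 f : nat, (0 < f)%N & (r %| q ^ f + 1)%N) :
  forall N : nat, exists a : {fraction {poly F}},
    nonconstant a /\ at_least_rational_points (X a) N.
Proof.
move=> N; case: hrq => f f0 rq.
(* Odd multiples of f, so that q^f + 1, and with it r, divides Q_i + 1. *)
pose e (i : nat) := (f * (2 * i).+1)%N; pose Q i := (q ^ e i)%N.
have q1 : (1 < q)%N by rewrite -hF finNzRing_gt1.
pose M := (\prod_(i < N) (Q i + 1))%N.
have M0 : (0 < M)%N by rewrite prodn_gt0 // => i; rewrite addn1.
pose c (i : 'I_N) := (M %/ (Q i + 1))%N.
have cM i : (c i * (Q i + 1))%N = M.
  by rewrite divnK // /M (bigD1 i) //= dvdn_mulr.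
have rQ i : (r %| Q i + 1)%N.
  by rewrite (dvdn_trans rq) // /Q /e expnM dvdn_odd_expn_add1.
pose t := ratX F; pose a := t ^+ M.
have t0 : t != 0 by exact: ratX_neq0.
pose x i := t ^+ c i.
have x0 i : x i != 0 by rewrite expf_neq0.
have xa i : a = x i ^+ (Q i + 1) by rewrite -exprM cM.
have x_inj i j : i != j -> x i <> x j.
  move=> ij /ratXn_inj cij; case/eqP: ij.
  have /eqP : (c i * (Q i + 1))%N = (c i * (Q j + 1))%N by rewrite cM cij cM.
  rewrite eqn_pmul2l; last by move: M0; rewrite -(cM i) muln_gt0 => /andP[].
  rewrite eqn_add2r eqn_exp2l // eqn_pmul2l // => /eqP[] /eqP.
  by rewrite eqn_pmul2l // => /eqP ij; apply: val_inj.
have anc : nonconstant a.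
  move=> b; rewrite /a /t /ratX -rmorphXn => /tofrac_inj.
  move/(congr1 (fun u : {poly F} => size u)); rewrite size_polyXn.
  by move=> E; have := size_polyC_leq1 b; rewrite -E ltnS leqNgt M0.
exists a; split=> //; have := hX _ anc; rewrite hhaE => -[smX genX].
have r0 : r%:R != 0 :> ratfun F.
  have pF : p \in [pchar ratfun F].
    by apply: (rmorph_pchar (@ratC F)); apply: (card_finPcharP (n := m)); rewrite ?hF.
  by rewrite -(dvdn_pcharf pF) -prime_coprime // coprime_sym.
have [d [B [C [Bd Cd branches]]]] := model_branch (ltnW hr) r0 genX.
pose H := map_poly (@ratC F) h.
(* H(x_i) is the polynomial h(t^(c_i)), whose value at t = 0 is h(0), as c_i is positive. *)
have Hx i : H.[x i] != 0.
  have ci0 : (0 < c i)%N by move: M0; rewrite -(cM i) muln_gt0 => /andP[].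
  have -> : H.[x i] = tofrac (h \Po 'X^(c i)).
    have -> : H = map_poly (@tofrac {poly F}) (map_poly polyC h).
      by rewrite -map_poly_comp.
    by rewrite /x /t /ratX -rmorphXn horner_map.
  rewrite tofrac_eq0; apply: contraNneq h0 => /(congr1 (fun u => u.[0])).
  by rewrite horner_comp hornerXn expr0n gtn_eqF // horner0 => ->.
(* Then y_i^r = h(x_i)^(Q_i + 1) = h(x_i) h(x_i^Q_i) = h(x_i) h(a / x_i). *)
pose y i := H.[x i] ^+ ((Q i + 1) %/ r).
have /fin_all_exists[v Ev] i : exists v : 'I_(ps_dim (X a)).+1 -> fps (ratfun F),
  [/\ forall G, G \in ps_eqs (X a) -> mmap (@fpsC (ratfun F)) v G = 0,
      exists j, fps0 (v j) != 0,
      (fpsX (ratfun F) + fpsC (x i)) * mmap (@fpsC (ratfun F)) v C =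
        mmap (@fpsC (ratfun F)) v B
    & mmap (@fpsC (ratfun F)) v C != 0].
  apply: (branches (x i) (y i)).
  - by rewrite hornerXn; exact: expf_neq0 (x0 i).
  - rewrite (hha_numE _ _ (x0 i)) hornerXn -/H; congr (_ * _).
    rewrite -exprM divnK // addn1 exprS; congr (_ * _).
    have -> : a / x i = x i ^+ (#|F| ^ e i).
      by rewrite (xa i) addn1 exprSr (mulfK (x0 i)) hF.
    rewrite /Q -hF; exact: (horner_frobenius _ h (x i) (e i) hp (etrans hF hq)).
  - exact: expf_neq0 (Hx i).
exists (fun i => \row_j fps0 (v i j)); split=> [i|i j ij l].
  by have [vX v0 _ _] := Ev i; apply: specialization_is_point.
have [viX vi0 Ei Ci] := Ev i; have [vjX _ Ej Cj] := Ev j.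
exact: specializations_distinct smX Bd Cd viX vi0 Ei Ci vjX Ej Cj (x_inj _ _ ij).
Qed.
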